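(* Let $d\ge 2$ be an odd integer and let $\omega\in\mathbb{C}$ satisfy $\omega^{d-1}=-1$. Then \[ M_d\cap\mathbb{R}^+\omega=\{t\omega:0\le t\le \gamma(d)\}, \] where \[ \gamma(d):=d^{-d/(d-1)}\bigl(\sinh(d\xi_d)+d\sinh(\xi_d)\bigr) \] and $\xi_d$ is the unique positive root of the equation $\cosh(d\xi_d)=d\cosh(\xi_d)$.
   Context: For an integer $d\ge2$ and $c\in\mathbb{C}$, let $p_c(z):=z^d+c$ and let $p_c^{[n]}:=p_c\circ\dots\circ p_c$ ($n$ times, with $p_c^{[0]}$ the identity). The multibrot set is \[ M_d:=\Bigl\{c\in\mathbb{C}: \sup_{n\ge0}|p_c^{[n]}(0)|<\infty\Bigr\}. \] Here $\mathbb{R}^+=[0,\infty)$ and $\mathbb{R}^+\omega=\{t\omega: t\in\mathbb{R},\ t\ge 0\}$. *)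

(* Defs.v *)
From Stdlib Require Import Reals Arith.
From Coquelicot Require Import Coquelicot.

Definition p (d : nat) (c z : C) : C := (z ^ d + c)%C.

(* The supremum is taken in the extended reals. *)
Definition multibrot (d : nat) (c : C) : Prop :=
  Rbar_lt (Sup_seq (fun n => Finite (Cmod (Nat.iter n (p d c) (RtoC 0)))))
          p_infty.

Definition ray (w c : C) : Prop :=
  exists t : R, (0 <= t)%R /\ c = (RtoC t * w)%C.

Definition is_xi (d : nat) (xi : R) : Prop :=
  (0 < xi)%R /\ (cosh (INR d * xi) = INR d * cosh xi)%R.

(* [gamma d xi] is the paper's gamma(d) when [xi] is the root xi_d. *)
Definition gamma (d : nat) (xi : R) : R :=
  (Rpower (INR d) (- (INR d / (INR d - 1)))
   * (sinh (INR d * xi) + INR d * sinh xi))%R.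

(* Main.v *)
Require Import Defs.
From Stdlib Require Import Reals Arith Lra Lia.
From Coquelicot Require Import Coquelicot.

(** On the ray spanned by [w] the dynamics is real.  Since d is odd and
    w^d = -w, the map z |-> z^d + t w sends x w to (t - x^d) w, so the question
    is for which t >= 0 the decreasing map f(x) = t - x^d has a bounded orbit
    of 0 ([iter_on_ray]).

    The threshold is the largest t for which f has a cycle of period two
    (-x, v), that is v = t + x^d and v^d = t + x, with x, v >= 0.  At the
    largest t two such cycles merge, and the multiplier d^2 (x v)^(d-1) is 1.
    Hence x v = d^(-2/(d-1)), which suggests x = d^(-1/(d-1)) e^(-xi) and
    v = d^(-1/(d-1)) e^xi.  The two cycle equations then become
    cosh(d xi) = d cosh xi and t = gamma(d) ([extremal_cycle]).

    Let (-x, v) be the cycle at g = gamma(d).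

    - If t = s g with 0 <= s <= 1, the interval [-s x, s v] is mapped into
      itself by f, because s^d <= s; so the orbit of 0 is bounded
      ([orbit_bounded]).

    - If t > g, put mu = d x^(d-1), which lies in (0,1).  Let -a, b and -a' be
      three consecutive points of the orbit with a >= 0, so that b = t + a^d
      and a' = b^d - t.  Then
      mu (a' - a) = (mu b^d - b) + (a^d - mu a) + (1 - mu) t.
      Both brackets are convex functions.  The choice of mu, together with the
      multiplier condition, says that they are minimal at b = v and a = x,
      where their sum is -(1 - mu) g.  So a grows at each double step by at
      least (1 - mu) (t - g) / mu > 0, and the orbit is unbounded
      ([orbit_escapes]). *)

(** * Powers *)

Open Scope R_scope.

Lemma pow_opp_odd (d : nat) (x : R) : Nat.Odd d -> (- x) ^ d = - x ^ d.
Proof.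
intros [k ->].
replace (2 * k + 1)%nat with (S (2 * k)) by lia.
rewrite <- !tech_pow_Rmult, !pow_mult.
replace ((- x) ^ 2) with (x ^ 2) by ring.
ring.
Qed.

(** The graph of the convex function y |-> y^(m+1) on the half-line lies above
    its tangent at [a]: from exponent m+1 to m+2 the gap is multiplied by y and
    increased by (m+1) a^m (y - a)^2. *)
Lemma pow_above_tangent (m : nat) (a y : R) : 0 <= a -> 0 <= y ->
  a ^ S m + INR (S m) * a ^ m * (y - a) <= y ^ S m.
Proof.
intros Ha Hy; induction m as [|m IH]; [simpl; lra|].
apply Rle_trans with (y * (a ^ S m + INR (S m) * a ^ m * (y - a)));
  [|rewrite <- (tech_pow_Rmult y (S m)); now apply Rmult_le_compat_l].
assert (Hsq : 0 <= INR (S m) * a ^ m * (y - a) ^ 2).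
{ apply Rmult_le_pos; [|apply pow2_ge_0].
  apply Rmult_le_pos; [apply pos_INR | now apply pow_le]. }
rewrite (S_INR (S m)).
rewrite <- !tech_pow_Rmult in *.
nra.
Qed.

Lemma pow_S_le_self (m : nat) (s : R) : 0 <= s <= 1 -> s ^ S m <= s.
Proof.
intros Hs.
assert (H : s ^ m <= 1 ^ m) by (apply pow_incr; lra).
rewrite pow1 in H.
simpl; nra.
Qed.

Lemma exp_INR_mult (n : nat) (x : R) : exp (INR n * x) = exp x ^ n.
Proof.
rewrite <- Rpower_pow by apply exp_pos.
unfold Rpower; now rewrite ln_exp.
Qed.

(** * The equation cosh (d xi) = d cosh xi *)

Lemma cosh_mult_increasing (D x y : R) : 1 < D -> 0 < x -> x < y ->
  cosh (D * x) - D * cosh x < cosh (D * y) - D * cosh y.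
Proof.
intros HD Hx Hxy.
apply (incr_function (fun u => cosh (D * u) - D * cosh u) 0 p_infty
         (fun u => D * (sinh (D * u) - sinh u))); simpl; auto.
- intros u _ _.
  unfold cosh, sinh; auto_derive; [exact I | field].
- intros u Hu _.
  assert (H : sinh u < sinh (D * u)) by (apply sinh_lt; nra).
  nra.
Qed.

Lemma exists_unique_xi (d : nat) : (2 <= d)%nat -> exists! xi : R, is_xi d xi.
Proof.
intros hd.
apply le_INR in hd; simpl in hd.
unfold is_xi; set (D := INR d) in *.
assert (Hcont : continuity (fun u => cosh (D * u) - D * cosh u)).
{ intros u; apply continuity_pt_filterlim.
  apply (ex_derive_continuous (fun u => cosh (D * u) - D * cosh u)).
  unfold cosh; auto_derive; exact I. }
(* At 2D the growth rate D - 1 >= 1 gives e^((D-1) 2D) > 2D. *)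
assert (Hpos : 0 < cosh (D * (2 * D)) - D * cosh (2 * D)).
{ assert (He : 2 * D < exp ((D - 1) * (2 * D))).
  { apply Rlt_le_trans with (1 + (D - 1) * (2 * D)); [nra|].
    apply exp_ineq1_le. }
  assert (Hm : exp (D * (2 * D)) = exp ((D - 1) * (2 * D)) * exp (2 * D)).
  { rewrite <- exp_plus; f_equal; ring. }
  assert (Hlt : exp (- (2 * D)) < exp (2 * D)) by (apply exp_increasing; lra).
  assert (H1 := exp_pos (2 * D)).
  assert (H2 := exp_pos (- (D * (2 * D)))).
  unfold cosh; rewrite Hm; nra. }
destruct (IVT _ 0 (2 * D) Hcont) as [xi [[Hxi _] Hroot]]; auto; try lra.
{ rewrite Rmult_0_r, cosh_0; lra. }
simpl in Hroot.
exists xi; split.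
- split; [|lra].
  destruct Hxi as [Hxi | <-]; auto.
  rewrite Rmult_0_r, cosh_0 in Hroot; lra.
- assert (Hxi0 : 0 < xi).
  { destruct Hxi as [Hxi | <-]; auto.
    rewrite Rmult_0_r, cosh_0 in Hroot; lra. }
  intros y [Hy Hy'].
  destruct (Rtotal_order xi y) as [H | [H | H]]; auto.
  + assert (K := cosh_mult_increasing D xi y); lra.
  + assert (K := cosh_mult_increasing D y xi); lra.
Qed.

(** * The parabolic cycle *)

(** With x = r e^(-xi) and v = r e^xi, where r = d^(-1/(d-1)), both cycle
    equations are the exponential form of cosh (d xi) = d cosh xi, because
    r = d r^d.  The last conjunct says that the cycle has multiplier 1, and the
    one before it that mu = d x^(d-1) = e^(-(d-1) xi) lies in (0,1). *)
Lemma extremal_cycle (m : nat) (xi : R) :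
  (1 <= m)%nat -> is_xi (S m) xi ->
  exists x v : R,
    0 < x /\ 0 < v /\
    v = gamma (S m) xi + x ^ S m /\
    v ^ S m = gamma (S m) xi + x /\
    0 < INR (S m) * x ^ m < 1 /\
    INR (S m) * x ^ m * (INR (S m) * v ^ m) = 1.
Proof.
intros Hm [Hxi Hcosh].
set (D := INR (S m)) in *.
assert (Hm1 : 1 <= INR m) by (apply (le_INR 1); exact Hm).
assert (HD : D = INR m + 1) by (unfold D; now rewrite S_INR).
set (r := Rpower D (- / (D - 1))).
assert (Hr : 0 < r) by apply exp_pos.
assert (Hrm : D * r ^ m = 1).
{ rewrite <- Rpower_pow by exact Hr.
  unfold r; rewrite Rpower_mult.
  replace (- / (D - 1) * INR m) with (- (1)) by (rewrite HD; field; lra).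
  rewrite Rpower_Ropp, Rpower_1 by lra; field; lra. }
assert (HrS : Rpower D (- (D / (D - 1))) = r ^ S m).
{ rewrite <- Rpower_pow by exact Hr.
  unfold r; rewrite Rpower_mult; f_equal; fold D; field; lra. }
assert (HrD : r = D * r ^ S m).
{ simpl; rewrite (Rmult_comm r), <- Rmult_assoc, Hrm; ring. }
assert (Hinv : exp xi * exp (- xi) = 1).
{ rewrite <- exp_plus, Rplus_opp_r; apply exp_0. }
assert (Hpinv : exp xi ^ m * exp (- xi) ^ m = 1).
{ rewrite <- Rpow_mult_distr, Hinv; apply pow1. }
assert (Hlt : exp (- xi) ^ m < 1).
{ rewrite <- exp_INR_mult, <- exp_0; apply exp_increasing; nra. }
assert (Hg : gamma (S m) xi = r ^ S m * (sinh (D * xi) + D * sinh xi)).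
{ unfold gamma; fold D; now rewrite HrS. }
assert (Ev : exp xi ^ S m = exp (D * xi)) by (unfold D; now rewrite exp_INR_mult).
assert (Ex : exp (- xi) ^ S m = exp (- (D * xi))).
{ unfold D; rewrite <- exp_INR_mult; f_equal; ring. }
assert (Hpx := pow_lt _ m (exp_pos (- xi))).
exists (r * exp (- xi)), (r * exp xi).
split; [|split; [|split; [|split; [|split]]]].
- apply Rmult_lt_0_compat; [exact Hr | apply exp_pos].
- apply Rmult_lt_0_compat; [exact Hr | apply exp_pos].
- rewrite Hg, Rpow_mult_distr, Ex.
  replace (r * exp xi) with (D * r ^ S m * exp xi) by now rewrite <- HrD.
  (* sinh (D xi) + exp (- D xi) = cosh (D xi) = D cosh xi *)
  replace (exp (- (D * xi))) with (D * cosh xi - sinh (D * xi))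
    by (rewrite <- Hcosh; unfold cosh, sinh; field).
  unfold cosh, sinh; field.
- rewrite Hg, Rpow_mult_distr, Ev.
  replace (r * exp (- xi)) with (D * r ^ S m * exp (- xi)) by now rewrite <- HrD.
  (* exp (D xi) = sinh (D xi) + cosh (D xi) = sinh (D xi) + D cosh xi *)
  replace (exp (D * xi)) with (D * cosh xi + sinh (D * xi))
    by (rewrite <- Hcosh; unfold cosh, sinh; field).
  unfold cosh, sinh; field.
- rewrite Rpow_mult_distr, <- Rmult_assoc, Hrm; lra.
- rewrite !Rpow_mult_distr, <- !Rmult_assoc, Hrm, Rmult_1_l.
  replace (exp (- xi) ^ m * D * r ^ m * exp xi ^ m)
    with ((D * r ^ m) * (exp xi ^ m * exp (- xi) ^ m)) by ring.
  rewrite Hrm, Hpinv; ring.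
Qed.

(** * The real dynamics *)

(** Shrinking the cycle at [g] by the factor [s] turns it into a trap for the
    parameter s g: the images of the endpoints fall inside since s^d <= s. *)
Lemma orbit_bounded (m : nat) (x v g s : R) :
  Nat.Odd (S m) -> 0 < x -> 0 < v ->
  v = g + x ^ S m -> v ^ S m = g + x -> 0 <= s <= 1 ->
  forall n, - (s * x) <= Nat.iter n (fun y => s * g - y ^ S m) 0 <= s * v.
Proof.
intros Hodd Hx Hv E1 E2 Hs n.
induction n as [|n IH]; [simpl; nra|].
rewrite Nat.iter_succ.
set (y := Nat.iter n _ 0) in *.
assert (Hss := pow_S_le_self m s Hs).
assert (Hxp := pow_lt x (S m) Hx).
assert (Hvp := pow_lt v (S m) Hv).
assert (Hup : y ^ S m <= (s * v) ^ S m).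
{ destruct (Rle_lt_dec 0 y) as [Hy | Hy].
  - apply pow_incr; lra.
  - assert (0 <= (- y) ^ S m) by (apply pow_le; lra).
    rewrite (pow_opp_odd _ y Hodd) in H.
    assert (0 <= (s * v) ^ S m) by (apply pow_le; nra).
    lra. }
assert (Hlo : - (s * x) ^ S m <= y ^ S m).
{ destruct (Rle_lt_dec 0 y) as [Hy | Hy].
  - assert (0 <= y ^ S m) by now apply pow_le.
    assert (0 <= (s * x) ^ S m) by (apply pow_le; nra).
    lra.
  - assert (H : (- y) ^ S m <= (s * x) ^ S m) by (apply pow_incr; lra).
    rewrite (pow_opp_odd _ y Hodd) in H; lra. }
rewrite Rpow_mult_distr in Hup, Hlo.
assert (s ^ S m * v ^ S m <= s * v ^ S m) by (apply Rmult_le_compat_r; lra).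
assert (s ^ S m * x ^ S m <= s * x ^ S m) by (apply Rmult_le_compat_r; lra).
assert (Ev : s * v ^ S m = s * g + s * x) by (rewrite E2; ring).
assert (Ex : s * v = s * g + s * x ^ S m) by (rewrite E1 at 1; ring).
lra.
Qed.

(** The two tangent inequalities, at [x] for a and at [v] for b, are added with
    weights 1 and mu.  The linear terms in a and b cancel by the definition of
    mu and by the multiplier condition. *)
Lemma double_step_gain (m : nat) (x v g t a : R) :
  let mu := INR (S m) * x ^ m in
  0 < x -> 0 < v -> v = g + x ^ S m -> v ^ S m = g + x ->
  0 < mu -> mu * (INR (S m) * v ^ m) = 1 ->
  0 <= t -> 0 <= a ->
  (1 - mu) * (t - g) <= mu * ((t + a ^ S m) ^ S m - t - a).
Proof.
intros mu Hx Hv E1 E2 Hmu Emu Ht Ha.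
assert (Hap := pow_le a (S m) Ha).
set (b := t + a ^ S m).
assert (Ta := pow_above_tangent m x a (Rlt_le _ _ Hx) Ha).
assert (Tb : v ^ S m + INR (S m) * v ^ m * (b - v) <= b ^ S m).
{ apply pow_above_tangent; [lra | unfold b; lra]. }
fold mu in Ta.
apply (Rmult_le_compat_l mu) in Tb; [|lra].
rewrite Rmult_plus_distr_l, <- (Rmult_assoc mu), Emu, E2 in Tb.
assert (Eb : b = t + a ^ S m) by reflexivity.
assert (Ep : x ^ S m = v - g) by lra.
rewrite Ep in Ta.
lra.
Qed.

Lemma orbit_escapes (m : nat) (x v g t : R) :
  let mu := INR (S m) * x ^ m in
  Nat.Odd (S m) -> 0 < x -> 0 < v -> v = g + x ^ S m -> v ^ S m = g + x ->
  0 < mu < 1 -> mu * (INR (S m) * v ^ m) = 1 ->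
  0 <= t -> g < t ->
  forall B, exists n, B < Rabs (Nat.iter n (fun y => t - y ^ S m) 0).
Proof.
intros mu Hodd Hx Hv E1 E2 Hmu Emu Ht Hgt.
set (f := fun y => t - y ^ S m).
set (delta := (1 - mu) * (t - g) / mu).
assert (Hdelta : 0 < delta).
{ unfold delta; apply Rdiv_lt_0_compat; [|lra].
  apply Rmult_lt_0_compat; lra. }
assert (Hgrow : forall n, INR n * delta <= - Nat.iter (2 * n) f 0).
{ induction n as [|n IH]; [simpl; lra|].
  replace (2 * S n)%nat with (S (S (2 * n))) by lia.
  rewrite !Nat.iter_succ.
  set (y := Nat.iter (2 * n) f 0) in *.
  assert (Ha : 0 <= - y).
  { assert (0 <= INR n * delta) by (apply Rmult_le_pos; [apply pos_INR | lra]).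
    lra. }
  assert (G := double_step_gain m x v g t (- y) Hx Hv E1 E2 (proj1 Hmu) Emu Ht Ha).
  fold mu in G.
  rewrite (pow_opp_odd _ y Hodd) in G.
  assert (Hd : delta <= (t + - y ^ S m) ^ S m - t - - y).
  { apply Rmult_le_reg_l with mu; [lra|].
    unfold delta; replace (mu * ((1 - mu) * (t - g) / mu))
      with ((1 - mu) * (t - g)) by (field; lra).
    exact G. }
  rewrite S_INR.
  unfold f, Rminus in *; lra. }
intros B.
destruct (INR_archimed delta B Hdelta) as [n Hn].
exists (2 * n)%nat.
assert (H := Hgrow n).
assert (K := Rle_abs (- Nat.iter (2 * n) f 0)).
rewrite Rabs_Ropp in K; lra.
Qed.

(** * Back to the complex plane *)

Lemma multibrot_iff_bounded (d : nat) (c : C) :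
  multibrot d c <->
  exists B : R, forall n, Cmod (Nat.iter n (p d c) (RtoC 0)) <= B.
Proof.
unfold multibrot.
set (u := fun n => Finite (Cmod (Nat.iter n (p d c) (RtoC 0)))).
assert (Hs := Sup_seq_correct u).
destruct (Sup_seq u) as [l | |]; simpl in Hs |- *; split; try easy.
- intros _; exists (l + 1); intros n.
  apply Rlt_le, (proj1 (Hs (mkposreal 1 Rlt_0_1)) n).
- intros [B HB].
  destruct (Hs B) as [n Hn].
  specialize (HB n); simpl in Hn; lra.
- intros _; exists 0; intros n.
  apply Rlt_le, (Hs 0 n).
Qed.

Lemma iter_on_ray (d : nat) (w : C) (t : R) (n : nat) :
  (w ^ d)%C = (- w)%C ->
  Nat.iter n (p d (RtoC t * w)%C) (RtoC 0) =
  (RtoC (Nat.iter n (fun y => t - y ^ d) 0)%R * w)%C.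
Proof.
intros Hw; induction n as [|n IH]; [simpl; ring|].
rewrite !Nat.iter_succ, IH.
unfold p; rewrite Cpow_mult_l, Hw, RtoC_minus, RtoC_pow; ring.
Qed.

Lemma multibrot_on_ray (d : nat) (w : C) (t : R) :
  (w ^ d)%C = (- w)%C -> w <> RtoC 0 ->
  multibrot d (RtoC t * w)%C <->
  exists B : R, forall n, Rabs (Nat.iter n (fun y => t - y ^ d) 0) <= B.
Proof.
intros Hw Hw0.
apply Cmod_gt_0 in Hw0.
rewrite multibrot_iff_bounded.
split; intros [B HB].
- exists (B / Cmod w); intros n.
  specialize (HB n).
  rewrite (iter_on_ray d w t n Hw), Cmod_mult, Cmod_R in HB.
  apply Rle_div_r; assumption.
- exists (B * Cmod w); intros n.
  rewrite (iter_on_ray d w t n Hw), Cmod_mult, Cmod_R.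
  apply Rmult_le_compat_r; [lra | apply HB].
Qed.

Close Scope R_scope.

Theorem theorem1p1 (d : nat) (hd : (2 <= d)%nat) (hodd : Nat.Odd d)
    (w : C) (hw : (w ^ (d - 1))%C = (- RtoC 1)%C) :
  (exists! xi : R, is_xi d xi) /\
  (forall xi : R, is_xi d xi ->
     forall c : C,
       (multibrot d c /\ ray w c) <->
       (exists t : R, (0 <= t <= gamma d xi)%R /\ c = (RtoC t * w)%C)).
Proof.
split; [now apply exists_unique_xi|].
intros xi Hxi c.
destruct d as [|m]; [lia|].
replace (S m - 1)%nat with m in hw by lia.
assert (Hw : (w ^ S m)%C = (- w)%C) by (rewrite Cpow_S, hw; ring).
assert (Hw0 : w <> RtoC 0).
{ intros ->.
  destruct m as [|m]; [lia|].
  rewrite Cpow_S, Cmult_0_l in hw.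
  injection hw; lra. }
destruct (extremal_cycle m xi) as (x & v & Hx & Hv & E1 & E2 & Hmu & Emu);
  [lia | exact Hxi |].
set (g := gamma (S m) xi) in *.
split.
- intros [Hc [t [Ht ->]]].
  exists t; split; [|reflexivity].
  split; [exact Ht|].
  apply (multibrot_on_ray _ _ _ Hw Hw0) in Hc.
  destruct Hc as [B HB].
  destruct (Rle_lt_dec t g) as [|Hgt]; [assumption|].
  destruct (orbit_escapes m x v g t hodd Hx Hv E1 E2 Hmu Emu Ht Hgt B) as [n Hn].
  specialize (HB n); lra.
- intros [t [Ht ->]].
  split; [|exists t; split; [apply Ht | reflexivity]].
  apply (multibrot_on_ray _ _ _ Hw Hw0).
  assert (Hs : exists s, (0 <= s <= 1)%R /\ t = (s * g)%R).
  { destruct (Req_dec g 0) as [Hg | Hg].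
    - exists 0%R; lra.
    - exists (t / g)%R; split; [|field; exact Hg].
      split; [apply Rdiv_le_0_compat | apply Rle_div_l]; lra. }
  destruct Hs as [s [Hs ->]].
  exists (s * x + s * v)%R; intros n.
  assert (H := orbit_bounded m x v g s hodd Hx Hv E1 E2 Hs n).
  assert (0 <= s * x)%R by (apply Rmult_le_pos; lra).
  assert (0 <= s * v)%R by (apply Rmult_le_pos; lra).
  apply Rabs_le; lra.
Qed.
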